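(* Let $r\ge 3$ be a positive integer and let $n\ge 3$ be an odd integer. Then $$\mathsf s(C_2^{r-1}\oplus C_{2n})\le 4n+2^r-5.$$
   Context: $C_m$ denotes the cyclic group of order $m$, and $C_m^k$ the direct sum of $k$ copies of $C_m$. Groups are finite abelian, written additively; $\exp(G)$ is the exponent of $G$. A sequence over $G$ is a finite unordered sequence of elements of $G$ with repetition allowed (a multiset; an element of the free abelian monoid with basis $G$). Its length is the number of terms counted with multiplicity; a subsequence is a sub-multiset; it is zero-sum if the sum of its terms (with multiplicity) is $0$. The Erdős–Ginzburg–Ziv constant $\mathsf s(G)$ is the smallest positive integer $l$ such that every sequence $S$ over $G$ of length $|S|\ge l$ has a zero-sum subsequence $T$ of length $|T|=\exp(G)$. *)

(* Defs.v *)
From HB Require Import structures.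
From mathcomp Require Import all_boot all_order all_fingroup all_algebra all_solvable.
From mathcomp Require Import finmap multiset boolp.

Set Implicit Arguments.
Unset Strict Implicit.
Unset Printing Implicit Defensive.

Import GRing.Theory.

Local Open Scope ring_scope.
Local Open Scope mset_scope.

(* MathComp leaves out the join instances for products, among them
   finZmodType. *)
HB.saturate prod.

(* Written additively: the group law is +%R. The ring 'Z_m is cyclic of order
   m only for m >= 2 ('Z_0 and 'Z_1 are both of order 2). *)
Definition C2pow_C (k m : nat) : finZmodType := ('rV['Z_2]_k * 'Z_m)%type.

(* A finZmodType coerces to its additive finite group, so this is the exponent
   with respect to +%R. *)
Definition exp_group (G : finZmodType) : nat := exponent [set: G].

(* Sequences are unordered, hence multisets; size counts multiplicities and
   `<=` is inclusion of multisets. *)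
Definition EGZ_property (G : finZmodType) (l : nat) : Prop :=
  (0 < l)%N /\
  forall S : {mset G}, (l <= size S)%N ->
    exists T : {mset G},
      [/\ T `<=` S, size T = exp_group G & \sum_(x <- T) x = 0].

Lemma exp_group_gt0 (G : finZmodType) : (0 < exp_group G)%N.
Proof. exact: (exponent_gt0 [set: G]%G). Qed.

Lemma mulrn_exp_group (G : finZmodType) (x : G) : x *+ exp_group G = 0.
Proof.
have /expg_exponent := in_setT x.
by rewrite FinRing.zmodXgE.
Qed.

Lemma EGZ_property_ex (G : finZmodType) : exists l, `[< EGZ_property G l >].
Proof.
exists (#|G| * exp_group G).+1; apply/asboolP; split=> // S ltS.
have [x leS] : exists x, (exp_group G <= S x)%N.
  apply/not_existsP => noS; move: ltS; rewrite ltnNge => /negP; apply.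
  rewrite size_mset.
  apply: (@leq_trans (\sum_(a <- finsupp S) exp_group G)).
    by apply: leq_sum => a _; rewrite ltnW // ltnNge; apply/negP/noS.
  rewrite big_const_seq count_predT iter_addn_0 mulnC leq_mul2r cardE.
  apply/orP; right; apply: uniq_leq_size (fset_uniq _) _ => a _.
  by rewrite mem_enum.
exists (msetn (exp_group G) x); split.
- by apply/msubsetP=> y; rewrite msetnE; case: eqP => [->|].
- by rewrite enum_msetn size_nseq.
- by rewrite enum_msetn big_nseq iter_addr_0 mulrn_exp_group.
Qed.

(* The Erdos-Ginzburg-Ziv constant s(G). *)
Definition EGZ (G : finZmodType) : nat := ex_minn (EGZ_property_ex G).

(* Main.v *)
Require Import Defs.
From mathcomp Require Import all_boot all_algebra.
From mathcomp Require Import all_fingroup all_solvable finmap multiset boolp.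
From mathcomp Require Import zify ring.

(* Write C_2^(r-1) + C_(2n) as V x Z/n with V = C_2^r.  If n = p m, then from
   4n + |V| - 5 elements one can extract 2m - 1 disjoint blocks of length 2p
   with sum zero in V x Z/p, and the Erdos-Ginzburg-Ziv theorem for m combines
   m of them; so n = p may be taken to be an odd prime.

   For n = p, pair elements with the same V-component as long as possible: a
   pair has V-sum 0, so 2p - 1 pairs would suffice by Erdos-Ginzburg-Ziv. In a
   counterexample, a parity count leaves 2p - 2 pairs and a rest R containing
   every class of V but one exactly once. By the inverse theorem the pairs have
   two weights a and b, each p - 1 times, and the sums of p - 2 pairs miss only
   the value -(a + b). Hence any four elements of R with V-sum 0 have weight
   a + b, which forces all of R to have one weight c, with a + b = 4c. Exchanging
   an element of R with an element of a pair of the same class would give that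
   pair the weight 2c, hence a = b; so all pairs lie in the class missing from R.
   They can then be recombined at will without changing a + b = 4c, and this is
   impossible. *)

Set Implicit Arguments.
Unset Strict Implicit.
Unset Printing Implicit Defensive.

(** * Subsequences up to permutation *)

Section Subsequences.
Local Open Scope ring_scope.
Import GRing.Theory.

(** The complement [R] is kept explicit, so that further selections can be made from what is
    left. *)
Definition contains (A : eqType) (P : seq A -> Prop) (s : seq A) : Prop :=
  exists T R, perm_eq s (T ++ R) /\ P T.

Lemma perm_contains (A : eqType) (P : seq A -> Prop) (s1 s2 R : seq A) :
  perm_eq s2 (s1 ++ R) -> contains P s1 -> contains P s2.
Proof.
move=> eq21 [T [R' [eq1 PT]]]; exists T, (R' ++ R); split=> //.
by rewrite (perm_trans eq21) // catA perm_cat2r.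
Qed.

Lemma contains_sub (A : eqType) (P Q : seq A -> Prop) (s : seq A) :
  (forall T, P T -> Q T) -> contains P s -> contains Q s.
Proof. by move=> PQ [T [R [eq PT]]]; exists T, R; split=> //; apply: PQ. Qed.

Lemma contains_flatten (A : eqType) (P : seq A -> Prop)
    (Q : seq (seq A) -> Prop) (bs : seq (seq A)) :
    (forall T, {subset T <= bs} -> Q T -> P (flatten T)) ->
  contains Q bs -> contains P (flatten bs).
Proof.
move=> QP [T [R [eq QT]]]; exists (flatten T), (flatten R); split.
  by rewrite -flatten_cat; apply: perm_flatten.
by apply: QP => // x xT; rewrite (perm_mem eq) mem_cat xT.
Qed.

(** Greedy: each block removed costs [t] terms, and the last block still finds [N] terms. *)
Lemma extract_blocks (A : eqType) (P : seq A -> Prop) (t N : nat) :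
    (forall T, P T -> size T = t) ->
    (forall s, (N <= size s)%N -> contains P s) ->
  forall k s, (N + t * k <= size s)%N ->
  exists bs R, [/\ perm_eq s (flatten bs ++ R), size bs = k.+1
                 & forall b, b \in bs -> P b].
Proof.
move=> szP Pbig; elim=> [|k IHk] s sz_s.
  have [|T [R [eqs PT]]] := Pbig s; first by lia.
  by exists [:: T], R; split=> //= [|b]; rewrite ?cats0 // inE => /eqP->.
have [|T [R [eqs PT]]] := Pbig s; first by lia.
have [|bs [R' [eqR sz_bs Pbs]]] := IHk R.
  by move: (perm_size eqs); rewrite size_cat (szP T) //; lia.
exists (T :: bs), R'; split=> [|/=|b].
- by rewrite (perm_trans eqs) //= -catA perm_cat2l.
- by rewrite sz_bs.
- by rewrite inE => /predU1P[->//|/Pbs].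
Qed.

Lemma size_flatten_const (A : eqType) (t : nat) (bs : seq (seq A)) :
  (forall b, b \in bs -> size b = t) -> size (flatten bs) = (t * size bs)%N.
Proof.
elim: bs => [|b bs IH] szb /=; first by rewrite muln0.
rewrite size_cat szb ?mem_head // IH; first by rewrite mulnS.
by move=> c cbs; apply: szb; rewrite inE cbs orbT.
Qed.

Lemma uniq_sub_perm (A : eqType) (Q R : seq A) :
  uniq Q -> {subset Q <= R} -> exists R', perm_eq R (Q ++ R').
Proof.
move=> uQ QR; have [] := count_subseqP Q R.
have le x : (count_mem x Q <= count_mem x R)%N.
  by rewrite count_uniq_mem //; case xQ: (x \in Q); rewrite // -has_count has_pred1 QR.
move=> /(_ le)[Q' /perm_to_subseq[R' eqR] eqQ] _.
by exists R'; rewrite (perm_trans eqR) // perm_cat2r perm_sym.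
Qed.

Lemma count_two_levels (A : Type) (B : eqType) (f : A -> B) (s : seq A) (c d : B) :
  c != d ->
  (count (fun x => f x == c) s + count (fun x => f x == d) s
   + count (fun x => (f x != c) && (f x != d)) s = size s)%N.
Proof.
move=> /negPf cd; elim: s => //= x t <-; have [->|] := eqVneq (f x) c.
  by rewrite cd; lia.
by case: eqVneq => _ _; lia.
Qed.

Definition unpair (A : Type) (ps : seq (A * A)) : seq A :=
  flatten [seq [:: x.1; x.2] | x <- ps].

Lemma unpair_cons (A : Type) (x : A * A) (ps : seq (A * A)) :
  unpair (x :: ps) = [:: x.1, x.2 & unpair ps].
Proof. by []. Qed.

Lemma size_unpair (A : Type) (ps : seq (A * A)) : size (unpair ps) = (2 * size ps)%N.
Proof. by elim: ps => // x ps; rewrite unpair_cons /= => ->; lia. Qed.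

Lemma perm_unpair (A : eqType) (ps qs : seq (A * A)) :
  perm_eq ps qs -> perm_eq (unpair ps) (unpair qs).
Proof. by move=> eq; apply/perm_flatten/perm_map. Qed.

Lemma unpair_cat (A : Type) (ps qs : seq (A * A)) :
  unpair (ps ++ qs) = unpair ps ++ unpair qs.
Proof. by rewrite /unpair map_cat flatten_cat. Qed.

Lemma big_unpair (A : Type) (V : zmodType) (g : A -> V) (ps : seq (A * A)) :
  \sum_(x <- unpair ps) g x = \sum_(x <- ps) (g x.1 + g x.2).
Proof.
elim: ps => [|x ps IH]; first by rewrite !big_nil.
by rewrite unpair_cons !big_cons addrA -IH.
Qed.

End Subsequences.

(** * Subset sums modulo a prime *)

Section PrimeSums.
Local Open Scope ring_scope.
Import GRing.Theory.
Variables (p : nat) (p_pr : prime p).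

(** A nonempty set closed under adding [d] would be all of ['F_p], since the multiples of [d]
    exhaust it. *)
Lemma translate_escapes (X : {set 'F_p}) (d : 'F_p) :
  d != 0 -> X != set0 -> X != setT -> exists2 y, y \in X & y + d \notin X.
Proof.
move=> d0 /set0Pn[x0 xX] XT; apply/exists_inP; apply: contraT => /exists_inPn noy.
have X_d y : y \in X -> y + d \in X by move=> /noy; rewrite negbK.
case/eqP: XT; apply/setP=> z; rewrite inE.
have X_k k : x0 + d *+ k \in X.
  by elim: k => [|k IHk]; rewrite ?addr0 // mulrSr addrA X_d.
suff -> : z = x0 + d *+ val ((z - x0) / d) by apply: X_k.
by rewrite -mulr_natr natr_Zp mulrC divfK // addrC subrK.
Qed.

Section Weights.
Variables (A : eqType) (f : A -> 'F_p).

(** One term is chosen from each pair. Every pair enlarges the set of sums by at least one until it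
    is everything: the Cauchy-Davenport theorem for two-element summands. *)
Lemma sums_of_pairs (ps : seq (A * A)) :
    (forall x, x \in ps -> f x.1 != f x.2) ->
  exists X : {set 'F_p}, (minn p (size ps).+1 <= #|X|)%N /\
    forall u, u \in X ->
      contains (fun T => size T = size ps /\ \sum_(x <- T) f x = u) (unpair ps).
Proof.
elim: ps => [_|[a b] ps IH fps].
  exists [set 0]; split; first by rewrite cards1 geq_minr.
  by move=> u /set1P->; exists [::], [::]; rewrite big_nil.
have [|X [cardX sumX]] := IH.
  by move=> x xps; apply: fps; rewrite inE xps orbT.
have fab : f a != f b by apply: (fps (a, b)); rewrite mem_head.
exists ([set f a + u | u in X] :|: [set f b + u | u in X]); split; last first.
  move=> u /setUP[] /imsetP[u' /sumX[T [R [eqT [szT <-]]]] ->].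
    exists (a :: T), (b :: R); rewrite /= szT big_cons; split=> //.
    apply/seq.permP=> P; move/seq.permP: eqT => /(_ P).
    by rewrite ?unpair_cons /= !count_cat /=; lia.
  exists (b :: T), (a :: R); rewrite /= szT big_cons; split=> //.
  apply/seq.permP=> P; move/seq.permP: eqT => /(_ P).
  by rewrite ?unpair_cons /= !count_cat /=; lia.
have card_im c : #|[set c + u | u in X]| = #|X|.
  by rewrite card_imset //; apply: addrI.
have [XT|XnT] := eqVneq X setT.
  apply: leq_trans (subset_leq_card (subsetUl _ _)).
  by rewrite card_im XT cardsT card_Fp // geq_minl.
have X0 : X != set0.
  by rewrite -card_gt0; apply: leq_trans cardX; rewrite leq_min prime_gt0.
have d0 : f b - f a != 0 by rewrite subr_eq0 eq_sym.
have [y yX ydX] := translate_escapes d0 X0 XnT.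
(* Since [y + (f b - f a)] is not in [X], the sum [f b + y] lies outside the translate [f a + X]. *)
have : (#|X|.+1 <= #|(f b + y)%R |: [set (f a + u)%R | u in X]|)%N.
  rewrite cardsU1 card_im -add1n leq_add2r lt0b.
  apply: contra ydX => /imsetP[u uX e].
  by rewrite addrA (addrC y) e addrC addKr.
move=> lt; apply: leq_trans (leq_trans lt _).
  by move: cardX => /=; lia.
apply: subset_leq_card; rewrite subUset subsetUl andbT sub1set.
by rewrite inE (imset_f (fun u => f b + u)) ?orbT.
Qed.

(* After sorting by weight, an entry and the one [m - k] places further agree
   only if some weight occurs more than [m - k] times. *)
Lemma distinct_pairs (s : seq A) (k : nat) :
    (2 * k <= size s)%N ->
    (forall c, count (fun x => f x == c) s <= size s - k)%N ->
  exists ps R, [/\ perm_eq s (unpair ps ++ R), size ps = k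
                 & forall x, x \in ps -> f x.1 != f x.2].
Proof.
move=> le2k cnt; case: k => [|k] in le2k cnt *; first by exists [::], s.
case: s => [|x0 s0] in le2k cnt *; first by [].
set s := x0 :: s0 in le2k cnt *; set m := size s in le2k cnt *.
pose le := fun x y : A => (f x <= f y)%N.
have le_tr : transitive le by move=> x y z; apply: leq_trans.
have le_tot : total le by move=> x y; apply: leq_total.
have le_refl : reflexive le by move=> x; apply: leqnn.
pose t := sort le s.
have t_sorted : sorted le t by apply: sort_sorted.
have st : perm_eq t s by rewrite /t perm_sort.
have szt : size t = m by rewrite (perm_size st).
have neq i : (i < k.+1)%N -> f (nth x0 t i) != f (nth x0 t (m - k.+1 + i)).
  move=> ik; apply/eqP=> e.
  have [c cE] : exists c, f (nth x0 t i) = c by exists (f (nth x0 t i)).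
  have /(_ c) := cnt; rewrite leqNgt => /negP; apply.
  rewrite -(seq.permP st) -(cat_take_drop i t) count_cat.
  apply: leq_trans (leq_addl _ _).
  rewrite -(cat_take_drop (m - k.+1).+1 (drop i t)) count_cat.
  apply: leq_trans (leq_addr _ _).
  have szd : size (take (m - k.+1).+1 (drop i t)) = (m - k.+1).+1.
    by rewrite size_take_min size_drop szt; lia.
  suff : all (fun x => f x == c) (take (m - k.+1).+1 (drop i t)).
    by rewrite all_count szd => /eqP->.
  apply/(all_nthP x0) => j; rewrite szd => jlt.
  rewrite nth_take // nth_drop -cE -val_eqE eqn_leq /=.
  apply/andP; split; last first.
    by apply: (sorted_leq_nth le_tr le_refl x0 t_sorted); rewrite ?inE ?szt; lia.
  rewrite e.
  by apply: (sorted_leq_nth le_tr le_refl x0 t_sorted); rewrite ?inE ?szt; lia.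
pose l := take k.+1 t; pose mid := drop k.+1 (take (m - k.+1) t).
pose h := drop (m - k.+1) t.
have szl : size l = k.+1 by rewrite /l size_take_min szt; lia.
have szh : size h = k.+1 by rewrite /h size_drop szt; lia.
exists (zip l h), mid; split.
- have tE : t = l ++ mid ++ h.
    rewrite catA /h -[in LHS](cat_take_drop (m - k.+1) t); congr (_ ++ _).
    rewrite -[LHS](cat_take_drop k.+1) /l /mid; congr (_ ++ _).
    by rewrite take_takel //; lia.
  rewrite -(permPl st) tE.
  have pz (u v : seq A) : size u = size v -> perm_eq (unpair (zip u v)) (u ++ v).
    elim: u v => [|x u IHu] [|y v] //= [/IHu/seq.permP e].
    by apply/seq.permP=> P; move: (e P); rewrite ?unpair_cons /= !count_cat /=; lia.
  apply/seq.permP=> P; rewrite !count_cat.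
  by rewrite (seq.permP (pz l h _)) ?szl ?szh // count_cat; lia.
- by rewrite size_zip szl szh minnn.
- move=> x /(nthP (x0, x0))[i]; rewrite size_zip szl szh minnn => ik <-.
  rewrite nth_zip ?szl ?szh //= /l /h nth_take // nth_drop; exact: neq.
Qed.

(** All terms outside [k] pairs of unequal weights are kept, and one term of each pair is dropped;
    [sums_of_pairs] counts the sums that arise. *)
Lemma selection_sums (s : seq A) (k : nat) :
    (2 * k <= size s)%N -> (k < p)%N ->
    (forall c, count (fun x => f x == c) s <= size s - k)%N ->
  exists X : {set 'F_p}, (k < #|X|)%N /\
    forall u, u \in X -> contains
      (fun T => size T = (size s - k)%N /\ \sum_(x <- T) f x = u) s.
Proof.
move=> le2k ltkp cnt; have [ps [R [eqs szp fps]]] := distinct_pairs le2k cnt.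
have [X [cardX sumX]] := sums_of_pairs fps.
exists [set \sum_(x <- R) f x + u | u in X]; split.
  rewrite card_imset; last exact: addrI.
  by apply: leq_trans cardX; rewrite szp leq_min ltkp ltnSn.
move=> u /imsetP[u' /sumX[T [R' [eqT [szT sumT]]]] ->].
exists (R ++ T), R'; split.
  apply/seq.permP=> P; move/seq.permP/(_ P): eqs; move/seq.permP/(_ P): eqT.
  by rewrite !count_cat; lia.
split; last by rewrite big_cat sumT.
by move: (perm_size eqs); rewrite !size_cat size_unpair szp szT szp; lia.
Qed.

Lemma take_level (s : seq A) (c : 'F_p) (k : nat) :
    (k <= count (fun x => f x == c) s)%N ->
  exists T R, [/\ perm_eq [seq x <- s | f x == c] (T ++ R), size T = k
                & \sum_(x <- T) f x = c *+ k].
Proof.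
move=> kc; exists (take k [seq x <- s | f x == c]).
exists (drop k [seq x <- s | f x == c]); rewrite cat_take_drop.
have szk : size (take k [seq x <- s | f x == c]) = k.
  by rewrite size_take_min size_filter; lia.
split=> //; rewrite big_seq (eq_bigr (fun=> c)) => [|x /mem_take]; last first.
  by rewrite mem_filter => /andP[/eqP].
by rewrite -big_seq big_const_seq count_predT szk iter_addr_0.
Qed.

Lemma egz_constant (s : seq A) (c : 'F_p) :
  (p <= count (fun x => f x == c) s)%N ->
  contains (fun T => size T = p /\ \sum_(x <- T) f x = 0) s.
Proof.
move=> /take_level[T [R [eqT szT sumT]]]; exists T.
exists (R ++ [seq x <- s | predC (fun x => f x == c) x]); split.
  by rewrite catA -(perm_filterC (fun x => f x == c)) perm_cat2r.
by rewrite sumT -mulr_natr pchar_Fp_0 ?mulr0.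
Qed.

(** If no weight occurs [p] times, dropping [p - 1] of [2p - 1] terms yields all [p] residues, among
    them 0. *)
Lemma egz_prime (s : seq A) :
  (2 * p - 1 <= size s)%N ->
  contains (fun T => size T = p /\ \sum_(x <- T) f x = 0) s.
Proof.
move=> sz_s; have p_gt1 := prime_gt1 p_pr.
suff main t : size t = (2 * p - 1)%N ->
    contains (fun T => size T = p /\ \sum_(x <- T) f x = 0) t.
  have := main (take (2 * p - 1) s); rewrite size_take_min.
  move=> /(_ ltac:(lia)) c; apply: (perm_contains (R := drop (2 * p - 1) s)) c.
  by rewrite cat_take_drop.
move=> {s sz_s} sz.
have [/existsP[c /egz_constant//]|/existsPn small] :=
  boolP [exists c, p <= count (fun x => f x == c) t]%N.
have [||c|X [cX sumX]] := @selection_sums t (p - 1).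
- by rewrite sz; lia.
- by lia.
- by have := small c; rewrite sz; lia.
have XT : X = setT.
  by apply/eqP; rewrite eqEcard subsetT cardsT card_Fp //; lia.
have := sumX 0; rewrite XT inE => /(_ isT); rewrite sz.
by have -> : (2 * p - 1 - (p - 1) = p)%N by lia.
Qed.

End Weights.
End PrimeSums.

(** * The inverse Erdos-Ginzburg-Ziv theorem for primes *)

Section InverseEGZ.
Local Open Scope ring_scope.
Import GRing.Theory.
Variables (p : nat) (p_pr : prime p) (p_gt2 : (2 < p)%N).
Variables (A : eqType) (f : A -> 'F_p).

(* Choosing two of [x, y, z] gives three sums, and [p - 2] of the elements of [l]
   take at least [p - 2] sums; since 3 + (p - 2) > p, two of these cancel. *)
Lemma egz_three_values (s l : seq A) (x y z : A) :
    perm_eq s [:: x, y, z & l] -> size l = (2 * p - 5)%N ->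
    f x != f y -> f x != f z -> f y != f z ->
    (forall c, count (fun t => f t == c) l <= p - 2)%N ->
  contains (fun T => size T = p /\ \sum_(x <- T) f x = 0) s.
Proof.
move=> eqs szl xy xz yz cnt.
have [||c|X [cX sumX]] := @selection_sums p p_pr A f l (p - 3).
- by lia.
- by lia.
- by have := cnt c; rewrite szl; lia.
pose Y := [set - (f x + f y); - (f x + f z); - (f y + f z)].
have cY : #|Y| = 3.
  rewrite /Y setUC !cardsU1 cards1 !inE !eqr_opp.
  have addl u v w : (u + v == u + w :> 'F_p) = (v == w) by rewrite (inj_eq (addrI u)).
  rewrite (addrC (f x) (f y)) addl (addrC (f y) (f x)) addl.
  rewrite (addrC (f y)) (addrC (f x)) addl.
  by rewrite (eq_sym (f z)) (eq_sym (f y)) (negPf xz) (negPf xy) yz.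
have /set0Pn[u /setIP[uX uY]] : X :&: Y != set0.
  rewrite -card_gt0; have := cardsUI X Y; rewrite cY.
  have : (#|X :|: Y| <= #|{: 'F_p}|)%N by apply: max_card.
  by rewrite card_Fp //; lia.
have [T [R [eqT [szT sumT]]]] := sumX u uX.
have pick (a b c : A) : perm_eq [:: x; y; z] [:: a; b; c] -> u = - (f a + f b) ->
    contains (fun T => size T = p /\ \sum_(x <- T) f x = 0) s.
  move=> eqxyz uE; exists [:: a, b & T], (c :: R); split.
    rewrite (perm_trans eqs) //.
    apply: perm_trans (_ : perm_eq _ ([:: a; b; c] ++ (T ++ R))) _.
      by rewrite -[[:: x, y, z & l]]/([:: x; y; z] ++ l) perm_cat.
    by rewrite /= !perm_cons (perm_catCA [:: c] T R).
  rewrite /= !big_cons sumT uE szT szl addrA addrN; split=> //.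
  by clear -p_gt2; lia.
move: uY; rewrite !inE -orbA => /or3P[] /eqP.
- exact: pick.
- by apply: (pick _ _ y); rewrite perm_cons (perm_catC [:: y]).
- by apply: (pick _ _ x); rewrite (perm_catC [:: x]).
Qed.

(** No weight occurs [p] times. With three terms of distinct weights whose removal leaves every
    weight at most [p - 2] times, [egz_three_values] would apply; such terms exist unless two
    weights fill the sequence. *)
Lemma egz_inverse (s : seq A) :
    size s = (2 * p - 2)%N ->
    ~ contains (fun T => size T = p /\ \sum_(x <- T) f x = 0) s ->
  exists a b, [/\ a != b, count (fun x => f x == a) s = (p - 1)%N
                & count (fun x => f x == b) s = (p - 1)%N].
Proof.
move=> szs nos.
have cnt c : (count (fun x => f x == c) s <= p - 1)%N.
  rewrite leqNgt; apply/negP=> lt; apply: nos; apply: (@egz_constant p p_pr _ _ _ c).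
  by lia.
have third x y : x \in s -> f x != f y ->
    (count (fun t => f t == f x) s + count (fun t => f t == f y) s < size s)%N ->
  exists2 z, z \in s & (f z != f x) && (f z != f y).
  by move=> xs xy lt; apply/hasP; rewrite has_count; have := count_two_levels f s xy; lia.
have split3 x y z : x \in s -> y \in s -> z \in s -> f y != f x ->
    (f z != f x) && (f z != f y) ->
    (forall c, count (fun t => f t == c) s <=
      p - 2 + ((f x == c) + ((f y == c) + (f z == c))))%N ->
  False.
  rewrite eq_sym => xs ys zs xy; rewrite ![f z == _]eq_sym => /andP[xz yz] small.
  apply: nos.
  have neq u v : f u != f v -> u != v by apply: contra => /eqP->.
  have [||l eqs] := @uniq_sub_perm _ [:: x; y; z] s.
  - by rewrite /= !inE negb_or !neq.
  - by move=> t; rewrite !inE => /or3P[] /eqP->.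
  apply: (egz_three_values eqs) => //.
  - by have := perm_size eqs; rewrite szs /=; lia.
  - by move=> c; have := small c; rewrite (seq.permP eqs) /=; clear; lia.
have [/existsP[a /eqP ca]|/existsPn small] :=
    boolP [exists a, count (fun x => f x == a) s == p - 1]%N.
- have /hasP[x xs /eqP fx] : has (fun x => f x == a) s by rewrite has_count ca; lia.
  have /hasP[y ys ya] : has (predC (fun x => f x == a)) s.
    by have := count_predC (fun x => f x == a) s; rewrite has_count ca szs; lia.
  rewrite /= -fx in ya.
  have [cb|cb] := eqVneq (count (fun x => f x == f y) s) (p - 1)%N.
    by exists a, (f y); rewrite eq_sym -fx ya fx.
  have [|||z zs zxy] := third x y; rewrite ?(eq_sym (f x)) //.
    by rewrite fx ca szs; have := cnt (f y); lia.
  case: (split3 x y z) => // c.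
  have [<-|xc] := eqVneq (f x) c; first by have := cnt (f x); lia.
  have [<-|yc] := eqVneq (f y) c; first by have := cnt (f y); lia.
  have [<-|zc] := eqVneq (f z) c; first by have := cnt (f z); lia.
  (* The weight [a] takes [p - 1] of the [2p - 2] places and [y] another, so [c] occurs at most
     [p - 2] times. *)
  have := count_two_levels f s xc; rewrite fx ca szs => sum_c.
  suff lt : (0 < count (fun t => (f t != a) && (f t != c)) s)%N.
    by clear - sum_c lt p_gt2; lia.
  by rewrite -has_count; apply/hasP; exists y; rewrite // yc -fx ya.
- have cnt2 c : (count (fun x => f x == c) s <= p - 2)%N.
    by have := cnt c; have := small c; lia.
  have /hasP[x xs _] : has predT s by rewrite has_predT szs; lia.
  have /hasP[y ys yx] : has (predC (fun t => f t == f x)) s.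
    have := count_predC (fun t => f t == f x) s; rewrite has_count.
    by have := cnt2 (f x); rewrite szs; lia.
  have [|||z zs zxy] := third x y; rewrite ?(eq_sym (f x)) //.
    by have := cnt2 (f x); have := cnt2 (f y); rewrite szs; lia.
  by case: (split3 x y z) => // c; apply: leq_trans (cnt2 c) (leq_addr _ _).
Qed.

(** Taking [i] terms of weight [a] and [p - 2 - i] of weight [b] gives [i(a - b) - 2b]. As [i] runs
    through 0, ..., [p - 2], the only residue missed is the one for [i = p - 1], namely
    [-(a + b)]. *)
Lemma fill_two_values (s : seq A) (a b u : 'F_p) :
    a != b -> count (fun x => f x == a) s = (p - 1)%N ->
    count (fun x => f x == b) s = (p - 1)%N -> u + a + b != 0 ->
  contains (fun T => size T = (p - 2)%N /\ \sum_(x <- T) f x = u) s.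
Proof.
move=> ab ca cb uab.
have [i [lti iE]] : exists i : nat, (i < p)%N /\ (a - b) *+ i = u + b *+ 2.
  exists (val ((u + b *+ 2) / (a - b))); split.
    by apply: leq_trans (ltn_ord _) _; rewrite Fp_cast.
  by rewrite -mulr_natr natr_Zp mulrC divfK // subr_eq0.
have li : (i <= p - 2)%N.
  suff : i != (p - 1)%N by lia.
  apply: contra uab => /eqP ip; apply/eqP.
  have -> : u + a + b = (u + b *+ 2) + (a - b) by ring.
  by rewrite -iE ip -mulrSr subn1 prednK ?prime_gt0 // -mulr_natr pchar_Fp_0 ?mulr0.
have [|Ta [Ra [eqa sza suma]]] := @take_level p p_pr A f s a i; first by lia.
have [|Tb [Rb [eqb szb sumb]]] := @take_level p p_pr A f s b (p - 2 - i); first by lia.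
exists (Ta ++ Tb), (Ra ++ Rb ++ [seq x <- s | (f x != a) && (f x != b)]); split.
  apply/seq.permP=> P; move/seq.permP/(_ P): eqa; move/seq.permP/(_ P): eqb.
  suff : count P s = (count P [seq x <- s | f x == a] + count P [seq x <- s | f x == b]
      + count P [seq x <- s | (f x != a) && (f x != b)])%N.
    by rewrite !count_cat; lia.
  elim: (s) => //= x t ->; have [->|_] := eqVneq (f x) a.
    by rewrite (negPf ab) /=; lia.
  by case: (f x == b) => /=; lia.
rewrite size_cat sza szb big_cat /= suma sumb; split; first by lia.
have -> : u = (a - b) *+ i - b *+ 2 by rewrite iE addrK.
have p0 : b *+ p = 0 by rewrite -mulr_natr pchar_Fp_0 ?mulr0.
by rewrite mulrnBl (mulrnBr _ li) (mulrnBr _ (ltnW p_gt2)) p0; ring.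
Qed.

End InverseEGZ.

(** * Odd prime n *)

Section PrimeCase.
Local Open Scope ring_scope.
Import GRing.Theory.
Variables (p : nat) (p_pr : prime p) (p_gt2 : (2 < p)%N).
Variables (V : finZmodType) (V2 : forall g : V, g + g = 0).
Variables (V_gt6 : (6 < #|V|)%N) (V_even : ~~ odd #|V|).
Variables (A : eqType) (v : A -> V) (w : A -> 'F_p).

Definition zero_sum_2p (T : seq A) : Prop :=
  [/\ size T = (2 * p)%N, \sum_(x <- T) v x = 0 & \sum_(x <- T) w x = 0].

Definition pair_weight (x : A * A) : 'F_p := w x.1 + w x.2.

(** Distinct classes in [R] express that the pairing is maximal. Which pairs are formed is left
    open, and the later exchanges use this freedom. *)
Definition pairing (s : seq A) (ps : seq (A * A)) (R : seq A) : Prop :=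
  [/\ perm_eq s (unpair ps ++ R), (forall x, x \in ps -> v x.1 = v x.2)
    & uniq (map v R)].

Lemma pairing_exists (s : seq A) : exists ps R, pairing s ps R.
Proof.
elim: s => [|x s [ps [R [eqs vps uR]]]]; first by exists [::], [::]; split.
have [/mapP[y yR vxy]|xR] := boolP (v x \in map v R); last first.
  exists ps, (x :: R); split; rewrite //= ?xR //.
  apply/seq.permP=> P; move/seq.permP/(_ P): eqs; rewrite /= !count_cat /=; lia.
exists ((x, y) :: ps), (rem y R); split.
- apply/seq.permP=> P; move/seq.permP/(_ P): eqs.
  move/seq.permP/(_ P): (perm_to_rem yR); rewrite unpair_cons /= !count_cat /=; lia.
- by move=> z; rewrite inE => /predU1P[->//|/vps].
- move: uR; rewrite (perm_uniq (perm_map v (perm_to_rem yR))) /=.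
  by case/andP.
Qed.

(** * Structure of a sequence without zero-sum subsequence of length 2p *)

Section NoZeroSum.
Variables (s : seq A) (szs : size s = (4 * p + #|V| - 5)%N).
Hypothesis nos : ~ contains zero_sum_2p s.

(** Pairs have [V]-sum 0, so [k] pairs of total weight [u] would complete [Q] to a zero-sum
    subsequence of length [2p]. *)
Lemma pairing_select (ps : seq (A * A)) (R Q R' : seq A) (k : nat) (u : 'F_p) :
    pairing s ps R -> perm_eq R (Q ++ R') -> (2 * k + size Q = 2 * p)%N ->
    \sum_(x <- Q) v x = 0 -> \sum_(x <- Q) w x = - u ->
  ~ contains (fun T => size T = k /\ \sum_(x <- T) pair_weight x = u) ps.
Proof.
move=> [eqs vps uR] eqR szQ vQ wQ [T [T' [eqps [szT wT]]]]; apply: nos.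
exists (unpair T ++ Q), (unpair T' ++ R'); split.
  apply/seq.permP=> P; move/seq.permP/(_ P): eqs; move/seq.permP/(_ P): eqR.
  move/seq.permP/(_ P): (perm_unpair eqps); rewrite unpair_cat !count_cat; lia.
split; first by rewrite size_cat size_unpair szT.
- rewrite big_cat /= vQ addr0 big_unpair big_seq big1 // => x xT.
  by rewrite vps ?V2 // (perm_mem eqps) mem_cat xT.
- by rewrite big_cat /= wQ big_unpair -/(pair_weight _) wT addrN.
Qed.

(** At most [2p - 2] pairs by Erdos-Ginzburg-Ziv gives [|R| >= |V| - 1], and [|R| = |V|] is
    impossible because [4p - 5] is odd. *)
Lemma pairing_size (ps : seq (A * A)) (R : seq A) :
  pairing s ps R -> size ps = (2 * p - 2)%N /\ size R = (#|V| - 1)%N.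
Proof.
move=> pair; have [eqs vps uR] := pair.
have szR : (size R <= #|V|)%N by rewrite -(size_map v) -(card_uniqP uR) max_card.
have := perm_size eqs; rewrite size_cat size_unpair szs => sz.
suff : (size ps < 2 * p - 1)%N by lia.
rewrite ltnNge; apply/negP=> /(@egz_prime p p_pr _ pair_weight).
by apply: (@pairing_select _ R [::] R) => //=; rewrite ?big_nil ?oppr0 ?addn0.
Qed.

Lemma pairing_weights (ps : seq (A * A)) (R : seq A) :
  pairing s ps R ->
  exists a b, [/\ a != b,
    count (fun x => pair_weight x == a) ps = (p - 1)%N
    & count (fun x => pair_weight x == b) ps = (p - 1)%N].
Proof.
move=> pair; have [szps _] := pairing_size pair.
apply: egz_inverse => //.
by apply: (@pairing_select _ R [::] R) => //=; rewrite ?big_nil ?oppr0 ?addn0.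
Qed.

Lemma double_inj (x y : 'F_p) : x + x = y + y -> x = y.
Proof.
move=> e; have two0 : (2%:R : 'F_p) != 0.
  rewrite -(dvdn_pcharf (pchar_Fp p_pr)); apply/negP=> /dvdn_leq; lia.
by apply: (mulIf two0); rewrite !mulr_natr !mulr2n.
Qed.

Lemma fresh (l : seq V) : (size l < #|V|)%N -> exists t, t \notin l.
Proof.
move=> lt; apply/existsP; apply: contraLR lt; rewrite -leqNgt => /existsPn all_l.
apply: leq_trans (card_size l); apply/subset_leq_card/subsetP=> t _.
by have := all_l t; rewrite negbK.
Qed.

Lemma missing_class (ps : seq (A * A)) (R : seq A) :
  pairing s ps R ->
  exists g0, forall g, (g \in map v R) = (g != g0).
Proof.
move=> pair; have [_ szR] := pairing_size pair; have [_ _ uR] := pair.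
have : #|[predC map v R]| = 1.
  have : (#|map v R| + #|[predC map v R]| = #|V|)%N := cardC _.
  by rewrite (card_uniqP uR) size_map szR; lia.
move=> /mem_card1[g0 g0P]; exists g0 => g; have := g0P g.
by rewrite !inE => <-; rewrite negbK.
Qed.

(** Otherwise [fill_two_values] would give [p - 2] pairs whose weight is minus that of [Q], and
    together with [Q] they would have length [2p]. *)
Lemma four_weights (ps : seq (A * A)) (R Q : seq A) (a b : 'F_p) :
    pairing s ps R -> a != b ->
    count (fun x => pair_weight x == a) ps = (p - 1)%N ->
    count (fun x => pair_weight x == b) ps = (p - 1)%N ->
    uniq Q -> {subset Q <= R} -> size Q = 4 -> \sum_(x <- Q) v x = 0 ->
  \sum_(x <- Q) w x = a + b.
Proof.
move=> pair ab ca cb uQ QR szQ vQ; have [R' eqR] := uniq_sub_perm uQ QR.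
apply/eqP; rewrite -subr_eq0 -oppr_eq0 opprB addrC addrA; apply: contraT => neq.
case: (@pairing_select _ _ _ _ (p - 2) (- \sum_(x <- Q) w x) pair eqR) => //.
- by rewrite szQ; lia.
- by rewrite opprK.
- exact: (fill_two_values p_pr p_gt2 ab ca cb neq).
Qed.

(** The weights of [R] become a function on the classes other than [g0]. Comparing zero-sum
    quadruples shows that any two distinct classes have the same weight sum; a common third class
    then gives equal weights. *)
Lemma rest_weights (ps : seq (A * A)) (R : seq A) (a b : 'F_p) :
    pairing s ps R -> a != b ->
    count (fun x => pair_weight x == a) ps = (p - 1)%N ->
    count (fun x => pair_weight x == b) ps = (p - 1)%N ->
  exists c, (forall x, x \in R -> w x = c) /\ a + b = c *+ 4.
Proof.
move=> pair ab ca cb; have [g0 g0P] := missing_class pair.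
have [_ szR] := pairing_size pair; have [_ _ uR] := pair.
have [x0 x0R] : exists x0, x0 \in R.
  have /hasP[x0 xR _] : has predT R by rewrite has_predT szR; lia.
  by exists x0.
(* The term of [R] in class [g]; the default [x0] is only used at [g = g0]. *)
pose rho g := nth x0 R (index g (map v R)).
have rhoR g : g != g0 -> rho g \in R.
  by rewrite -g0P => gR; rewrite mem_nth // -(size_map v) index_mem.
have v_rho g : g != g0 -> v (rho g) = g.
  rewrite -g0P => gR; rewrite /rho -(nth_map x0 (v x0)) ?nth_index //.
  by rewrite -(size_map v) index_mem.
have rho_v x : x \in R -> rho (v x) = x.
  move=> xR; rewrite /rho -{1}(nth_index x0 xR) -(nth_map x0 (v x0)) ?index_mem //.
  by rewrite index_uniq ?size_map ?index_mem // nth_index.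
pose f g := w (rho g).
have sq (g h : V) : g + h + g = h by rewrite addrAC V2 add0r.
have four g1 g2 g3 : g1 != g0 -> g2 != g0 -> g3 != g0 -> g1 + g2 + g3 != g0 ->
    g1 != g2 -> g1 != g3 -> g2 != g3 ->
    f g1 + f g2 + (f g3 + f (g1 + g2 + g3)) = a + b.
  move=> n1 n2 n3 n4 n12 n13 n23.
  pose Q := map rho [:: g1; g2; g3; g1 + g2 + g3].
  have vQ : map v Q = [:: g1; g2; g3; g1 + g2 + g3] by rewrite /= !v_rho.
  have -> : f g1 + f g2 + (f g3 + f (g1 + g2 + g3)) = \sum_(x <- Q) w x.
    by rewrite big_map !big_cons big_nil addr0 -addrA.
  apply: (four_weights pair ab ca cb) => //.
  - apply: (@map_uniq _ _ v); rewrite vQ /= !inE !negb_or n12 n13 n23 /= andbT.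
    have ne (g h k : V) : h != k -> g != g + h + k.
      apply: contra; rewrite -{1}[g]addr0 -addrA (inj_eq (addrI g)) eq_sym => /eqP e.
      by rewrite -(sq k h) [k + h]addrC e add0r.
    by rewrite ne // {1}(addrC g1) ne //= addrC addrA ne.
  - by move=> x /mapP[g]; rewrite !inE => /or4P[] /eqP-> ->; apply: rhoR.
  - have -> : \sum_(x <- Q) v x = \sum_(g <- map v Q) g by rewrite [RHS]big_map.
    by rewrite vQ !big_cons big_nil addr0 addrA addrA V2.
(* The pair {g, h} and two further pairs with the same difference d, all
   avoiding g0, have weights X, Y, Z with X + Y = X + Z = Y + Z = a + b. *)
have pair_const g h : g != g0 -> h != g0 -> g != h ->
    (f g + f h) + (f g + f h) = a + b.
  move=> ng nh ngh; pose d := g + h.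
  have d0 : d != 0.
    by apply: contra ngh => /eqP e; rewrite -(sq h g) [h + g]addrC -/d e add0r.
  have addd (x y : V) : x + d = y -> x = y + d by move=> <-; rewrite -addrA V2 addr0.
  have shift (x y : V) : x != y + d -> x + d != y by apply: contra => /eqP/addd->.
  have [t] := @fresh [:: g0; g0 + d; g; h] ltac:(exact: leq_trans V_gt6).
  rewrite !inE !negb_or => /and4P[tg0 tg0d tg th].
  (* Avoiding [g0 + d] keeps [t' + d] away from [g0]. The sets [{g, h}] and [{t, t + d}] are stable
     under adding [d], so [t' + d] avoids them too. Six classes are excluded, hence [V_gt6]. *)
  have [t'] := @fresh [:: g0; g0 + d; g; h; t; t + d] V_gt6.
  rewrite !inE !negb_or => /and5P[t'g0 t'g0d t'g t'h /andP[t't t'td]].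
  have e1 := four g h t ng nh tg0.
  have e2 := four g h t' ng nh t'g0.
  have e3 := four t (t + d) t' tg0.
  have td (x : V) : g + h + x = x + d by rewrite addrC.
  have tt (x y : V) : x + (x + d) + y = y + d by rewrite addrA V2 add0r addrC.
  rewrite !td in e1 e2; rewrite tt in e3.
  have {}e1 : f g + f h + (f t + f (t + d)) = a + b.
    by apply: e1; rewrite ?shift // eq_sym.
  have {}e2 : f g + f h + (f t' + f (t' + d)) = a + b.
    by apply: e2; rewrite ?shift // eq_sym.
  have {}e3 : f t + f (t + d) + (f t' + f (t' + d)) = a + b.
    apply: e3; rewrite ?(shift _ g0) //; try by rewrite eq_sym.
    by rewrite -{1}[t]addr0 (inj_eq (addrI t)) eq_sym.
  have tE : f t + f (t + d) = f t' + f (t' + d).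
    by apply: (addrI (f g + f h)); rewrite e1.
  suff -> : f g + f h = f t + f (t + d) by rewrite -e3 -tE.
  by apply: (addIr (f t + f (t + d))); rewrite e1 -e3 -tE.
have const g h : g != g0 -> h != g0 -> f g = f h.
  move=> ng nh; have [->//|ngh] := eqVneq g h.
  have [k] := @fresh [:: g0; g; h] ltac:(exact: leq_trans V_gt6).
  rewrite !inE !negb_or => /and3P[kg0 kg kh].
  apply: (addIr (f k)); apply: double_inj.
  by rewrite !pair_const // eq_sym.
have vR x : x \in R -> v x != g0 by move=> xR; rewrite -g0P map_f.
exists (f (v x0)); split.
  by move=> x xR; rewrite (const _ (v x)) ?vR // /f rho_v.
have [h] := @fresh [:: g0; v x0] ltac:(exact: leq_trans V_gt6).
rewrite !inE !negb_or => /andP[hg0 hx0].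
rewrite -(pair_const (v x0) h) ?vR // 1?eq_sym // (const h (v x0)) ?vR //.
by rewrite -[4%N]/(2 + 2)%N mulrnDr mulr2n.
Qed.

(** * Rearranging the pairs *)

Lemma perm_pairing (ps qs : seq (A * A)) (R R' : seq A) :
  perm_eq ps qs -> perm_eq R R' -> pairing s ps R -> pairing s qs R'.
Proof.
move=> eqps eqR [eqs vps uR]; split.
- by rewrite (perm_trans eqs) // perm_cat // perm_unpair.
- by move=> x; rewrite -(perm_mem eqps); apply: vps.
- by rewrite -(perm_uniq (perm_map v eqR)).
Qed.

Lemma pairing_exchange (ps : seq (A * A)) (R : seq A) (x y z : A) :
  pairing s ((x, y) :: ps) (z :: R) -> v z = v x ->
  pairing s ((z, y) :: ps) (x :: R).
Proof.
move=> [eqs vps uR] vzx; split.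
- apply/seq.permP=> P; rewrite (seq.permP eqs) !unpair_cons /= !count_cat /=; lia.
- move=> q; rewrite inE => /predU1P[->|qps]; last by rewrite vps // inE qps orbT.
  by have := vps (x, y); rewrite mem_head /= vzx; apply.
- by move: uR; rewrite /= vzx.
Qed.

Lemma pairing_swap (ps : seq (A * A)) (R : seq A) (x y x' y' : A) :
  pairing s [:: (x, y), (x', y') & ps] R -> v x = v x' ->
  pairing s [:: (x, x'), (y, y') & ps] R.
Proof.
move=> [eqs vps uR] vxx'; split=> //.
- apply/seq.permP=> P; rewrite (seq.permP eqs) !unpair_cons /= !count_cat /=; lia.
- have vxy : v x = v y by apply: (vps (x, y)); rewrite mem_head.
  have vxy' : v x' = v y' by apply: (vps (x', y')); rewrite !inE eqxx orbT.
  move=> q; rewrite !inE => /or3P[/eqP->|/eqP->|qps] //=.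
    by rewrite -vxy -vxy'.
  by rewrite vps // !inE qps !orbT.
Qed.

Lemma pairing_flip (ps : seq (A * A)) (R : seq A) (x y : A) :
  pairing s ((x, y) :: ps) R -> pairing s ((y, x) :: ps) R.
Proof.
move=> [eqs vps uR]; split=> //.
- by rewrite (perm_trans eqs) // !unpair_cons (perm_catCA [:: x] [:: y]).
- move=> q; rewrite inE => /predU1P[->|qps]; last by rewrite vps // inE qps orbT.
  by apply/esym/(vps (x, y)); rewrite mem_head.
Qed.

(** The weight pattern forced on every pairing of a counterexample: [a] and [b] on the pairs, [c] on
    the rest. *)
Definition balanced (ps : seq (A * A)) (R : seq A) (a b c : 'F_p) : Prop :=
  [/\ a != b, count (fun x => pair_weight x == a) ps = (p - 1)%N,
      count (fun x => pair_weight x == b) ps = (p - 1)%N,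
      forall x, x \in R -> w x = c & a + b = c *+ 4].

Lemma balanced_sym (ps : seq (A * A)) (R : seq A) (a b c : 'F_p) :
  balanced ps R a b c -> balanced ps R b a c.
Proof. by case=> ab ca cb wR e; split; rewrite // 1?eq_sym // addrC. Qed.

Lemma pairing_balanced (ps : seq (A * A)) (R : seq A) :
  pairing s ps R -> exists a b c, balanced ps R a b c.
Proof.
move=> pair; have [a [b [ab ca cb]]] := pairing_weights pair.
by have [c [wR e]] := rest_weights pair ab ca cb; exists a, b, c.
Qed.

Lemma balanced_values (ps : seq (A * A)) (R : seq A) (a b c : 'F_p) (q : A * A) :
  pairing s ps R -> balanced ps R a b c -> q \in ps ->
  pair_weight q = a \/ pair_weight q = b.
Proof.
move=> /pairing_size[szps _] [ab ca cb _ _] qps.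
have := count_two_levels pair_weight ps ab; rewrite ca cb szps.
have [->|qa] := eqVneq (pair_weight q) a; first by left.
have [->|qb] := eqVneq (pair_weight q) b; first by right.
suff : (0 < count (fun x => (pair_weight x != a) && (pair_weight x != b)) ps)%N by lia.
by rewrite -has_count; apply/hasP; exists q; rewrite ?qa.
Qed.

(** Exchanging either term of the pair with a term [z] of [R] in the same class leaves the other
    terms of [R] in place, so both terms of the pair have weight [c]. Then [2c] is [a] or [b], and
    [a + b = 4c] yields [a = b]. *)
Lemma pairing_missing (ps : seq (A * A)) (R : seq A) (q : A * A) :
  pairing s ps R -> q \in ps -> v q.1 \notin map v R.
Proof.
case: q => x y pair qps; apply/mapP=> -[z zR /= vxz].
have [a [b [c bal]]] := pairing_balanced pair.
have [_ szR] := pairing_size pair; have [ab _ _ wR e] := bal.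
have [_ vps _] := pair; have vxy : v x = v y := vps _ qps.
have eqps := perm_to_rem qps; have eqR := perm_to_rem zR.
have pair' := perm_pairing eqps eqR pair.
(* The term [t] stays in the rest through the exchange and carries the value [c] over to the new
   rest. *)
have /hasP[t tR _] : has predT (rem z R).
  by rewrite has_predT size_rem // szR; lia.
have wt : w t = c by rewrite wR // (mem_rem tR).
have rest u u' : pairing s ((u, u') :: rem (x, y) ps) (z :: rem z R) -> v u = v x ->
    w u = c.
  move=> pu vu; have := pairing_exchange pu; rewrite vu vxz => /(_ erefl).
  move=> /pairing_balanced[a' [b' [c' [_ _ _ wR' _]]]].
  by rewrite wR' ?mem_head // -(wR' t) // inE tR orbT.
have wx : w x = c by apply: (rest x y).
have wy : w y = c.
  by apply: (rest y x) => //; apply: pairing_flip.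
have qE : pair_weight (x, y) = c + c by rewrite /pair_weight wx wy.
have e' : a + b = (c + c) + (c + c) by rewrite e -[4%N]/(2 + 2)%N mulrnDr mulr2n.
case/eqP: ab; have [] := balanced_values pair bal qps; rewrite qE => cE.
  by move: e'; rewrite cE => /addrI.
by move: e'; rewrite cE => /addIr.
Qed.

Lemma pairing_same_class (ps : seq (A * A)) (R : seq A) (q r : A * A) :
  pairing s ps R -> q \in ps -> r \in ps -> v q.1 = v r.1.
Proof.
move=> pair qps rps; have [g0 g0P] := missing_class pair.
have := pairing_missing pair qps; have := pairing_missing pair rps.
by rewrite !g0P !negbK => /eqP-> /eqP->.
Qed.

(* Swapping within the pairs of weight [a] leaves the [p - 1] pairs of weight [b]
   and the sum [a + b] unchanged, so the new pairs again have weight [a]. *)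
Lemma balanced_swap (ps : seq (A * A)) (R : seq A) (a b c : 'F_p) (x y x' y' : A) :
    pairing s [:: (x, y), (x', y') & ps] R ->
    balanced [:: (x, y), (x', y') & ps] R a b c ->
    w x + w y = a -> w x' + w y' = a -> w x + w x' = a.
Proof.
move=> pair bal wxy wxy'; have [ab _ cb wR e] := bal.
have vxx' : v x = v x'.
  by apply: (pairing_same_class (q := (x, y)) (r := (x', y')) pair);
    rewrite !inE eqxx ?orbT.
have pair' := pairing_swap pair vxx'; have [a' [b' [c' bal']]] := pairing_balanced pair'.
have [_ szR] := pairing_size pair.
have /hasP[t tR _] : has predT R by rewrite has_predT szR; lia.
have {}cb : count (fun q => pair_weight q == b) ps = (p - 1)%N.
  by move: cb; rewrite /= /pair_weight /= wxy wxy' (negPf ab).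
(* [R] is unchanged, hence so is its common weight, and both sums are four times that weight. *)
have sumE : a' + b' = a + b.
  by case: bal' => _ _ _ wR' ->; rewrite e -(wR t) // -(wR' t).
have /hasP[q qps /eqP qb] : has (fun q => pair_weight q == b) ps.
  by rewrite has_count cb; lia.
have : b = a' \/ b = b'.
  by rewrite -qb; apply: (balanced_values pair' bal'); rewrite !inE qps !orbT.
wlog bE : a' b' bal' sumE / b = b' => [hwlog [ba'|bb']|_].
- by apply: (hwlog b' a'); rewrite 1?addrC //; [apply: balanced_sym|right].
- by apply: (hwlog a' b') => //; right.
have aE : a' = a by apply: (addIr b'); rewrite sumE bE.
have : (x, x') \in [:: (x, x'), (y, y') & ps] by rewrite mem_head.
case/(balanced_values pair' bal') => [xa|]; first by rewrite -aE -xa.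
rewrite -bE => xb.
(* Here [(x, x')] would be a further pair of weight [b] besides the [p - 1] in [ps]. *)
by case: bal' => _ _ + _ _; rewrite -bE /= cb xb eqxx; lia.
Qed.

(** Swapping with a second pair [(x', y')] of weight [a], in both orientations, gives
    [w x' = w y' = w y]; so [a] is twice [w y], and [w x = w y]. *)
Lemma balanced_halves (ps : seq (A * A)) (R : seq A) (a b c : 'F_p) (q : A * A) :
    pairing s ps R -> balanced ps R a b c -> q \in ps -> pair_weight q = a ->
  w q.1 = w q.2.
Proof.
case: q => x y pair bal qps /= qa; have eqps := perm_to_rem qps.
have /hasP[[x' y'] qps' /eqP qa'] : has (fun q => pair_weight q == a) (rem (x, y) ps).
  case: bal => _ + _ _ _; rewrite (seq.permP eqps) /= qa eqxx has_count; lia.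
have eqps' : perm_eq ps [:: (x, y), (x', y') & rem (x', y') (rem (x, y) ps)].
  by rewrite (perm_trans eqps) // perm_cons perm_to_rem.
have bal_perm qs : perm_eq ps qs -> balanced qs R a b c.
  by move=> eq; case: bal => ab ca cb wR e; split; rewrite // -(seq.permP eq).
set l := rem _ (rem _ _) in eqps'.
have pair1 := perm_pairing eqps' (perm_refl R) pair; have bal1 := bal_perm _ eqps'.
have pair2 : pairing s [:: (x, y), (y', x') & l] R.
  have swap q r : perm_eq [:: q, r & l] [:: r, q & l] by rewrite (perm_catCA [:: q] [:: r]).
  have := perm_pairing (swap _ _) (perm_refl R) pair1.
  by move=> /pairing_flip; apply: perm_pairing.
have bal2 : balanced [:: (x, y), (y', x') & l] R a b c.
  case: bal1 => ab ca cb wR e; split=> //.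
    by rewrite -ca /= /pair_weight /= (addrC (w y')).
  by rewrite -cb /= /pair_weight /= (addrC (w y')).
have wxx' := balanced_swap pair1 bal1 qa qa'.
have wxy' : w x + w y' = a.
  by apply: (balanced_swap pair2 bal2 qa); rewrite addrC.
have x'y : w x' = w y by apply: (addrI (w x)); rewrite wxx'; apply: esym.
have y'y : w y' = w y by apply: (addrI (w x)); rewrite wxy'; apply: esym.
apply: (addIr (w y)); rewrite -[LHS]/(pair_weight (x, y)) qa -qa'.
by rewrite /pair_weight x'y y'y.
Qed.

(* An a-pair (x, y) and a b-pair (x', y') have w x = w y and w x' = w y'; swapping
   them gives two pairs of the same weight (a + b) / 2, so a' = b' = (a + b) / 2. *)
Lemma no_pairing (ps : seq (A * A)) (R : seq A) : ~ pairing s ps R.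
Proof.
move=> pair; have [a [b [c bal]]] := pairing_balanced pair.
have [ab ca cb wR e] := bal.
have /hasP[[x y] qps /eqP qa] : has (fun q => pair_weight q == a) ps.
  by rewrite has_count ca; lia.
have eqps := perm_to_rem qps.
have /hasP[[x' y'] qps' /eqP qb] : has (fun q => pair_weight q == b) (rem (x, y) ps).
  by move: cb; rewrite (seq.permP eqps) /= qa (negPf ab) has_count; lia.
have wxy := balanced_halves pair bal qps qa.
have wxy' := balanced_halves pair (balanced_sym bal) (mem_rem qps') qb.
have eqps' : perm_eq ps [:: (x, y), (x', y') & rem (x', y') (rem (x, y) ps)].
  by rewrite (perm_trans eqps) // perm_cons perm_to_rem.
have pair1 := perm_pairing eqps' (perm_refl R) pair.
have vxx' := pairing_same_class pair qps (mem_rem qps').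
have pair2 := pairing_swap pair1 vxx'; have [a' [b' [c' bal']]] := pairing_balanced pair2.
have [_ szR] := pairing_size pair.
have /hasP[t tR _] : has predT R by rewrite has_predT szR; lia.
have sumE : a' + b' = a + b.
  by case: bal' => _ _ _ wR' ->; rewrite e -(wR t) // -(wR' t).
have sumE' : a + b = pair_weight (x, x') + pair_weight (x, x').
  move: wxy wxy' => /= wxy wxy'.
  by rewrite -qa -qb /pair_weight /= -wxy -wxy'; ring.
have [ab' _ _ _ _] := bal'; case/eqP: ab'.
have := balanced_values pair2 bal' (mem_head _ _).
case=> pE; move: sumE; rewrite sumE' pE.
  by move=> /addrI.
by move=> /addIr.
Qed.

End NoZeroSum.

Lemma prime_case (s : seq A) :
  (4 * p + #|V| - 5 <= size s)%N -> contains zero_sum_2p s.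
Proof.
move=> sz_s; set N := (4 * p + #|V| - 5)%N in sz_s.
apply: (perm_contains (s1 := take N s) (R := drop N s)).
  by rewrite cat_take_drop.
have [//|no] := pselect (contains zero_sum_2p (take N s)).
have [ps [R pair]] := pairing_exists (take N s).
by case: (no_pairing _ no pair); rewrite size_take_min; lia.
Qed.

End PrimeCase.

(** * Odd n, and the group C_2^k + C_(2n) *)

Section Composite.
Local Open Scope ring_scope.
Import GRing.Theory.

(** With natural numbers as weights, the sum of a block can be divided by a factor of the
    modulus. *)
Definition egz_holds (m : nat) : Prop :=
  forall (A : eqType) (f : A -> nat) (s : seq A), (2 * m - 1 <= size s)%N ->
  contains (fun T => size T = m /\ (m %| \sum_(x <- T) f x)%N) s.

Lemma natr_sum_eq0 (p : nat) (A : Type) (f : A -> nat) (s : seq A) :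
  prime p -> (\sum_(x <- s) ((f x)%:R : 'F_p) == 0) = (p %| \sum_(x <- s) f x)%N.
Proof. by move=> p_pr; rewrite -natr_sum -(dvdn_pcharf (pchar_Fp p_pr)). Qed.

Lemma sum_flatten_divn (A : eqType) (f : A -> nat) (p m : nat) (bs : seq (seq A)) :
    (forall b, b \in bs -> p %| \sum_(x <- b) f x)%N ->
    (m %| \sum_(b <- bs) (\sum_(x <- b) f x) %/ p)%N ->
  (p * m %| \sum_(x <- flatten bs) f x)%N.
Proof.
move=> pbs mbs.
have -> : (\sum_(x <- flatten bs) f x = p * \sum_(b <- bs) (\sum_(x <- b) f x) %/ p)%N.
  rewrite big_flatten big_distrr /= big_seq [in RHS]big_seq.
  by apply: eq_bigr => b /pbs pb; rewrite mulnC divnK.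
exact: dvdn_mul.
Qed.

Lemma egz_holds_prime (p : nat) : prime p -> egz_holds p.
Proof.
move=> p_pr A f s /(egz_prime p_pr (fun x => (f x)%:R)); apply: contains_sub.
by move=> T [szT /eqP]; rewrite natr_sum_eq0.
Qed.

(** Split off [2b - 1] blocks of length [a] with sums divisible by [a], then choose [b] of them by
    the quotients. The count is exact: [(2a - 1) + a(2b - 2) = 2ab - 1]. *)
Lemma egz_holds_mul (a b : nat) : (0 < a)%N -> (0 < b)%N ->
  egz_holds a -> egz_holds b -> egz_holds (a * b).
Proof.
move=> a0 b0 Ha Hb A f s sz_s.
have [||bs [R [eqs szbs Pbs]]] := @extract_blocks A
    (fun T => size T = a /\ (a %| \sum_(x <- T) f x)%N) a (2 * a - 1)
    _ (Ha A f) (2 * b - 2) s.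
- by move=> T [].
- by nia.
apply: (perm_contains eqs); apply: contains_flatten; last first.
  by apply: (Hb _ (fun B => (\sum_(x <- B) f x) %/ a)%N); rewrite szbs; lia.
move=> T Tbs [szT divT]; split; last first.
    by apply: (sum_flatten_divn _ divT) => B /Tbs/Pbs[].
  by rewrite (@size_flatten_const _ a) ?szT // => B /Tbs/Pbs[].
Qed.

Lemma egz_general (m : nat) : (0 < m)%N -> egz_holds m.
Proof.
elim/ltn_ind: m => m IH m0; have [m_le1|m_gt1] := leqP m 1.
  have -> : m = 1%N by lia.
  move=> A f [//|x s] _; exists [:: x], s; split=> //; split=> //.
have p_pr := pdiv_prime m_gt1; have p_gt1 := prime_gt1 p_pr.
have mE := divnK (pdiv_dvd m).
have q0 : (0 < m %/ pdiv m)%N by rewrite divn_gt0 ?pdiv_gt0 // dvdn_leq ?pdiv_dvd.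
have := egz_holds_mul q0 (ltnW p_gt1) (IH _ _ q0) (egz_holds_prime p_pr).
by rewrite mE; apply; rewrite ltn_Pdiv.
Qed.

(** With [n = m p] for an odd prime [p], there is room for [2m - 1] blocks of length [2p], since
    [4p + |V| - 5 + 2p(2m - 2) = 4n + |V| - 5]; [m] of them are chosen by their weights divided by
    [p]. *)
Lemma odd_case (V : finZmodType) (A : eqType) (v : A -> V) (w : A -> nat)
    (n : nat) (s : seq A) :
    (forall g : V, g + g = 0) -> (6 < #|V|)%N -> ~~ odd #|V| ->
    odd n -> (3 <= n)%N -> (4 * n + #|V| - 5 <= size s)%N ->
  contains (fun T => [/\ size T = (2 * n)%N, \sum_(x <- T) v x = 0
    & (n %| \sum_(x <- T) w x)%N]) s.
Proof.
move=> V2 V_gt6 V_even n_odd n_ge3 sz_s.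
have p_pr : prime (pdiv n) by rewrite pdiv_prime //; lia.
have p_gt2 : (2 < pdiv n)%N.
  have := prime_gt1 p_pr; have := dvdn_odd (pdiv_dvd n) n_odd.
  by case: (pdiv n) => [|[|[|]]].
have := divnK (pdiv_dvd n); set p := pdiv n in p_pr p_gt2 *; set m := (n %/ p)%N.
move=> nE; have m0 : (0 < m)%N by nia.
have [|||bs [R [eqs szbs Pbs]]] := @extract_blocks A
    (fun T => [/\ size T = (2 * p)%N, \sum_(x <- T) v x = 0
                & (p %| \sum_(x <- T) w x)%N])
    (2 * p) (4 * p + #|V| - 5) _ _ (2 * m - 2) s.
- by move=> T [].
- move=> t /(prime_case p_pr p_gt2 V2 V_gt6 V_even v (fun x => (w x)%:R)).
  by apply: contains_sub => T [szT vT /eqP]; rewrite natr_sum_eq0.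
- by nia.
apply: (perm_contains eqs); apply: contains_flatten; last first.
  by apply: (egz_general m0 (fun b => (\sum_(x <- b) w x) %/ p)%N); rewrite szbs; lia.
move=> T Tbs [szT divT]; split.
- rewrite (@size_flatten_const _ (2 * p)) ?szT => [|B /Tbs/Pbs[]//].
  by rewrite -nE; nia.
- rewrite big_flatten big_seq big1 // => B /Tbs/Pbs[] //.
- rewrite -nE mulnC; apply: (sum_flatten_divn _ divT) => B /Tbs/Pbs[] //.
Qed.

End Composite.

(** * Transfer to the group C_2^k + C_(2n) *)

Section Bridge.
Local Open Scope ring_scope.
Import GRing.Theory.

Lemma Zp_natr_eq0 (m k : nat) : (1 < m)%N -> ((k%:R : 'Z_m) == 0) = (m %| k)%N.
Proof.
by move=> m1; rewrite -(inj_eq val_inj) /= val_Zp_nat.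
Qed.

Lemma sum_pair (U W : zmodType) (A : Type) (f : A -> U) (g : A -> W) (s : seq A) :
  \sum_(x <- s) (f x, g x) = (\sum_(x <- s) f x, \sum_(x <- s) g x).
Proof. by elim: s => [|x s IH]; rewrite ?big_nil // !big_cons IH. Qed.

Lemma Z2_double (x : 'Z_2) : x + x = 0.
Proof. by apply/val_inj; case: x => [[|[|]]]. Qed.

Lemma row_Z2_double (k : nat) (x : 'rV['Z_2]_k) : x + x = 0.
Proof. by apply/matrixP=> i j; rewrite !mxE Z2_double. Qed.

Lemma exp_C2pow_C (k n : nat) : (0 < n)%N -> exp_group (C2pow_C k (2 * n)) = (2 * n)%N.
Proof.
move=> n0; have m1 : (1 < 2 * n)%N by lia.
apply/eqP; rewrite eqn_dvd; apply/andP; split.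
  apply/exponentP => -[a b] _; rewrite FinRing.zmodXgE.
  have -> i : (a, b) *+ i = (a *+ i, b *+ i) by elim: i => // i IH; rewrite !mulrS IH.
  congr pair; first by rewrite mulrnA mulr2n row_Z2_double mul0rn.
  by rewrite -mulr_natr pchar_Zp ?mulr0.
set e := exp_group _; rewrite -Zp_natr_eq0 //; apply/eqP.
(* The element [(0, 1)] has order [2n], so [2n] divides the exponent. *)
have <- : ((0, 1) *+ e : C2pow_C k (2 * n)).2 = e%:R.
  by elim: (e) => // i IH; rewrite !mulrS -IH.
by rewrite mulrn_exp_group.
Qed.

(** As [n] is odd, C_(2n) splits as C_2 + C_n: the parity of the last coordinate is absorbed into
    [V], of order [2 ^ k.+1], and the coordinate itself serves as weight modulo [n]. *)
Lemma C2pow_C_zero_sum (k n : nat) (S : seq (C2pow_C k (2 * n))) :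
    (2 <= k)%N -> (3 <= n)%N -> odd n -> (4 * n + 2 ^ k.+1 - 5 <= size S)%N ->
  contains (fun T => size T = (2 * n)%N /\ \sum_(x <- T) x = 0) S.
Proof.
move=> k2 n3 n_odd szS; have m1 : (1 < 2 * n)%N by lia.
pose V : finZmodType := ('rV['Z_2]_k * 'Z_2)%type.
have cardV : #|V| = (2 ^ k.+1)%N.
  by rewrite card_prod card_mx card_ord mul1n expnSr.
pose v (x : C2pow_C k (2 * n)) : V := (x.1, (val x.2)%:R).
have := @odd_case V _ v (fun x => val x.2) n S.
rewrite cardV => /(_ _ _ _ n_odd n3 szS) H.
apply: contains_sub (H _ _ _).
- move=> T [szT]; rewrite sum_pair => -[sum1 /eqP]; rewrite -natr_sum Zp_natr_eq0 //.
  move=> div2 divn; split=> //.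
  rewrite (eq_bigr (fun x => (x.1, x.2))) => [|[]//]; rewrite sum_pair sum1.
  congr pair; rewrite (eq_bigr (fun x : C2pow_C k (2 * n) => (val x.2)%:R)).
    by rewrite -natr_sum; apply/eqP; rewrite Zp_natr_eq0 // Gauss_dvd ?div2 // coprime2n.
  by move=> x _; rewrite natr_Zp.
- by case=> a b; congr pair; rewrite ?row_Z2_double ?Z2_double.
- by apply: leq_trans (leq_pexp2l _ (_ : 3 <= k.+1)%N).
- by rewrite oddX.
Qed.

End Bridge.

Theorem theorem1p1 (r n : nat) (hr : (3 <= r)%N) (hn : (3 <= n)%N)
    (hodd : odd n) :
  (EGZ (C2pow_C (r - 1) (2 * n)) <= 4 * n + 2 ^ r - 5)%N.
Proof.
(* By minimality of [EGZ] it suffices that the bound itself has the property. *)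
rewrite /EGZ; case: ex_minnP => l _; apply; apply/asboolP; split; first by lia.
move=> S szS; have [||||T [R [eqS [szT sumT]]]] := @C2pow_C_zero_sum (r - 1) n S => //.
- by lia.
- by have -> : (2 ^ (r - 1).+1 = 2 ^ r)%N by congr (2 ^ _)%N; lia.
exists (seq_mset T); have eqT := perm_eq_seq_mset T; split.
- apply/msubsetP=> x; rewrite mset_seqE -count_mem_mset (seq.permP eqS) count_cat.
  exact: leq_addr.
- by rewrite (perm_size eqT) szT exp_C2pow_C //; lia.
- by rewrite (perm_big _ eqT).
Qed.
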